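(* Let $n,d,K\in\mathbb{N}$ with $1\le K\le d$. (1) For every $W_{enc}\in\mathbb{R}^{d\times n}$ and $b_{enc}\in\mathbb{R}^d$, the cells $\{\Omega_S^{\mathrm{TopK}}\}$, with $S$ ranging over the $K$-element subsets of $\{1,\dots,d\}$, form a $K$-th order power diagram with $\binom dK$ cells. Explicitly, $\Omega^{\mathrm{TopK}}_S=C_S$ for all $S$, where $\{C_S\}$ is the $K$-th order power diagram with centroids and weights $$\mu_i=W_{enc}^Te_i,\qquad \alpha_i=2(b_{enc})_i+\|W_{enc}^Te_i\|_2^2,\qquad i=1,\dots,d.$$ (2) Conversely, for any $K$-th order power diagram $\{C_S\}$ with $\binom dK$ cells given by centroids $\{\mu_i\}_{i=1}^d\subset\mathbb{R}^n$ and weights $\{\alpha_i\}_{i=1}^d\subset\mathbb{R}$, there exist $W_{enc}\in\mathbb{R}^{d\times n}$ and $b_{enc}\in\mathbb{R}^d$ such that the resulting TopK SAE is affine on the cells of that $K$-th order power diagram; explicitly, $\Omega^{\mathrm{TopK}}_S=C_S$ for all $S$ if $$e_i^TW_{enc}=\mu_i^T,\qquad (b_{enc})_i=\tfrac12\alpha_i-\tfrac12\|\mu_i\|_2^2,\qquad i=1,\dots,d.$$ (3) For every $W_{enc}$, $b_{enc}$ the cells $\{\Omega_S^{\mathrm{TopK}}\}$ form a power diagram with $\binom dK$ cells, given by the centroids $\{\nu_S\}$ and weights $\{\beta_S\}$ defined by $$\nu_S:=\frac1K\sum_{i\in S}W_{enc}^Te_i,\qquad \beta_S:=\Big\|\frac1K\sum_{i\in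 S}W_{enc}^Te_i\Big\|_2^2+\frac1K\sum_{i\in S}2(b_{enc})_i .$$ (4) The converse of (3) is false in general: there exist $n,d,K$ and a power diagram in $\mathbb{R}^n$ with $\binom dK$ cells which is not the family of cells $\{\Omega_S^{\mathrm{TopK}}\}$ for any $W_{enc},b_{enc}$. A given power diagram in $\mathbb{R}^n$ with $\binom dK$ cells is the family of cells $\{\Omega^{\mathrm{TopK}}_S\}$ of a TopK SAE for some $W_{enc}\in\mathbb{R}^{d\times n}$, $b_{enc}\in\mathbb{R}^d$ if and only if it can be written as a $K$-th order power diagram with $d$ centroids and weights.
   Context: $e_i$ is the $i$-th standard basis vector of $\mathbb{R}^d$. For $W_{enc}\in\mathbb{R}^{d\times n}$, $b_{enc}\in\mathbb{R}^d$ and $S\subseteq\{1,\dots,d\}$ with $|S|=K$, $$\Omega_S^{\mathrm{TopK}}:=\{x\in\mathbb{R}^n:\ (W_{enc}x+b_{enc})_i>(W_{enc}x+b_{enc})_j\ \text{ for all } i\in S,\ j\notin S\}.$$ Given also $W_{dec}\in\mathbb{R}^{n\times d}$, $b_{dec}\in\mathbb{R}^n$, the TopK sparse autoencoder (SAE) is $x\mapsto W_{dec}\,\mathrm{TopK}(W_{enc}x+b_{enc})+b_{dec}$, where $\mathrm{TopK}$ keeps the $K$ largest entries of a vector and sets the others to zero; on $\Omega_S^{\mathrm{TopK}}$ it equals $W_{dec}P_S(W_{enc}x+b_{enc})+b_{dec}$, where $P_S$ zeroes the entries with index not in $S$. A power diagram in $\mathbb{R}^n$ with centroids $\{\mu_i\}_{i=1}^k\subset\mathbb{R}^n$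 and weights $\{\alpha_i\}_{i=1}^k\subset\mathbb{R}$ is the family of $k$ cells $C_i:=\{x\in\mathbb{R}^n:\|x-\mu_i\|_2^2-\alpha_i<\|x-\mu_j\|_2^2-\alpha_j\ \text{for all } j\ne i\}$ (cells may be empty). The $K$-th order power diagram with centroids $\{\mu_i\}_{i=1}^k$ and weights $\{\alpha_i\}_{i=1}^k$ is the family of $\binom kK$ cells, indexed by $S\subseteq\{1,\dots,k\}$ with $|S|=K$, $$C_S:=\{x\in\mathbb{R}^n:\|x-\mu_i\|_2^2-\alpha_i<\|x-\mu_j\|_2^2-\alpha_j\ \text{for all } i\in S,\ j\in S^c\}.$$ In (4), two families of $\binom dK$ cells are considered the same if they coincide up to a bijection of their index sets. *)

(* Defs.v *)
From HB Require Import structures.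
From mathcomp Require Import all_boot all_order all_algebra.
From mathcomp Require Import boolp classical_sets reals.

Set Implicit Arguments.
Unset Strict Implicit.
Unset Printing Implicit Defensive.

Import Order.TTheory GRing.Theory Num.Theory.
Local Open Scope classical_set_scope.
Local Open Scope ring_scope.

(* Vectors are columns. The norm MathComp-Analysis puts on matrices is the
   sup norm, hence this separate Euclidean norm. *)
Definition norm2 (R : realType) (n : nat) (x : 'cV[R]_n) : R :=
  Num.sqrt (\sum_(k < n) x k 0 ^+ 2).

Definition stdvec (R : realType) (d : nat) (i : 'I_d) : 'cV[R]_d :=
  delta_mx i 0.

Definition ksubset (d K : nat) := {S : {set 'I_d} | #|S| == K}.

(* Centroids need not be distinct, and cells may be empty. *)
Definition power_cell (R : realType) (n : nat) (I : Type)
    (mu : I -> 'cV[R]_n) (alpha : I -> R) (i : I) : set 'cV[R]_n :=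
  [set x | forall j : I, j <> i ->
    norm2 (x - mu i) ^+ 2 - alpha i < norm2 (x - mu j) ^+ 2 - alpha j].

Definition korder_cell (R : realType) (n k K : nat)
    (mu : 'I_k -> 'cV[R]_n) (alpha : 'I_k -> R) (S : ksubset k K) :
    set 'cV[R]_n :=
  [set x | forall i j : 'I_k, i \in val S -> j \notin val S ->
    norm2 (x - mu i) ^+ 2 - alpha i < norm2 (x - mu j) ^+ 2 - alpha j].

Definition topk_cell (R : realType) (n d K : nat)
    (Wenc : 'M[R]_(d, n)) (benc : 'cV[R]_d) (S : ksubset d K) :
    set 'cV[R]_n :=
  [set x | forall i j : 'I_d, i \in val S -> j \notin val S ->
    (Wenc *m x + benc) j 0 < (Wenc *m x + benc) i 0].

Definition restrict_to (R : realType) (d : nat) (S : {set 'I_d})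
    (z : 'cV[R]_d) : 'cV[R]_d :=
  \col_(i < d) (if i \in S then z i 0 else 0).

(* "Keeps the K largest entries and zeroes the others" does not determine a
   function when entries are tied, so this is a predicate satisfied by the
   TopK map of every tie-breaking rule; see [is_topk_exists]. *)
Definition is_topk (R : realType) (d K : nat)
    (T : 'cV[R]_d -> 'cV[R]_d) : Prop :=
  forall z : 'cV[R]_d, exists S : ksubset d K,
    (forall i j : 'I_d, i \in val S -> j \notin val S -> z j 0 <= z i 0) /\
    T z = restrict_to (val S) z.

Lemma largest_entries_exist (R : realType) (d K : nat) (z : 'cV[R]_d) :
  (K <= d)%N -> exists S : ksubset d K,
    forall i j : 'I_d, i \in val S -> j \notin val S -> z j 0 <= z i 0.
Proof.
elim: K => [|K IHK] leKd.
  have S0 : #|(finset.set0 : {set 'I_d})| == 0%N by rewrite cards0.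
  by exists (Sub finset.set0 S0) => i j; rewrite SubK finset.in_set0.
have [[S cS] /= domS] := IHK (ltnW leKd).
have /card_gt0P [i0 i0S] : (0 < #|finset.setC S|)%N.
  by rewrite cardsCs finset.setCK card_ord (eqP cS) subn_gt0.
have [m mS maxm] := arg_maxP (fun i : 'I_d => z i 0) i0S.
have mNS : m \notin S by rewrite -finset.in_setC.
have cmS : #|finset.setU [set m]%SET S| == K.+1.
  by rewrite cardsU1 mNS (eqP cS).
exists (Sub (finset.setU [set m]%SET S) cmS) => i j.
rewrite SubK !finset.in_setU1 negb_or.
move=> /orP [/eqP -> | iS] /andP [jm jS]; last exact: domS.
by apply: maxm; apply: (etrans (finset.in_setC _ _)).
Qed.

Lemma is_topk_exists (R : realType) (d K : nat) :
  (K <= d)%N -> exists T : 'cV[R]_d -> 'cV[R]_d, is_topk K T.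
Proof.
move=> leKd.
have [s hs] := boolp.choice
  (fun z : 'cV[R]_d => largest_entries_exist z leKd).
by exists (fun z => restrict_to (val (s z)) z) => z; exists (s z); split; first exact: hs.
Qed.

Definition sae (R : realType) (n d : nat) (T : 'cV[R]_d -> 'cV[R]_d)
    (Wenc : 'M[R]_(d, n)) (benc : 'cV[R]_d)
    (Wdec : 'M[R]_(n, d)) (bdec : 'cV[R]_n) (x : 'cV[R]_n) : 'cV[R]_n :=
  Wdec *m T (Wenc *m x + benc) + bdec.

Definition affine_on (R : realType) (n m : nat) (C : set 'cV[R]_n)
    (f : 'cV[R]_n -> 'cV[R]_m) : Prop :=
  exists (A : 'M[R]_(m, n)) (c : 'cV[R]_m),
    forall x, C x -> f x = A *m x + c.

Definition same_cells (T I J : Type) (F : I -> set T) (G : J -> set T) : Prop :=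
  exists f : I -> J, bijective f /\ forall i, F i = G (f i).

(* Main.v *)
(* Expanding the squares, |x - mu|^2 - (|mu|^2 + 2 b) = |x|^2 - 2 (mu.x + b):
   comparing power distances is comparing the pre-activations z = W x + b in
   reverse order. Averaging over S, the power distance to nu_S becomes
   |x|^2 - (2/K) sum_(i in S) z_i, and S consists of the K strictly largest
   entries exactly when its sum strictly beats that of every other K-subset.
   Counterexample for the converse: on the real line with d = 4, K = 2, the
   cells {0,1}, {2,3}, {0,2}, {1,3} cannot all be nonempty, since passing
   between complementary cells fixes signs of slope differences, and these
   signs conflict; six distinct centroids of equal weight have six nonempty
   cells. *)
Require Import Defs.
From HB Require Import structures.
From mathcomp Require Import all_boot all_order all_algebra.
From mathcomp Require Import boolp classical_sets reals.
From mathcomp Require Import ring lra.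

Set Implicit Arguments.
Unset Strict Implicit.
Unset Printing Implicit Defensive.

Import Order.TTheory GRing.Theory Num.Theory.
Local Open Scope ring_scope.

(** * Power distances as affine functions *)

Lemma sqr_norm2 (R : realType) (n : nat) (x : 'cV[R]_n) :
  norm2 x ^+ 2 = \sum_(k < n) x k 0 ^+ 2.
Proof. by rewrite sqr_sqrtr // sumr_ge0 // => k _; exact: sqr_ge0. Qed.

Lemma sqr_norm2B (R : realType) (n : nat) (x m : 'cV[R]_n) :
  norm2 (x - m) ^+ 2 = norm2 x ^+ 2 - 2 * (m^T *m x) 0 0 + norm2 m ^+ 2.
Proof.
rewrite !sqr_norm2 mxE mulr_sumr -sumrB -big_split /=.
by apply: eq_bigr => k _; rewrite !mxE; ring.
Qed.

(** The offset [b] is left free so that this serves both single centroids and averages of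
    centroids. *)
Lemma power_distE (R : realType) (n : nat) (x m : 'cV[R]_n) (a b : R) :
  a = norm2 m ^+ 2 + 2 * b ->
  norm2 (x - m) ^+ 2 - a = norm2 x ^+ 2 - 2 * ((m^T *m x) 0 0 + b).
Proof. by move=> ->; rewrite sqr_norm2B; ring. Qed.

Lemma ltr_sub_2mull (R : realType) (c s t : R) :
  (c - 2 * s < c - 2 * t) = (t < s).
Proof. by rewrite ltrD2l ltrN2 ltr_pM2l. Qed.

Lemma preactivationE (R : realType) (n d : nat) (W : 'M[R]_(d, n))
    (b : 'cV[R]_d) (x : 'cV[R]_n) (i : 'I_d) :
  (W *m x + b) i 0 = ((W^T *m stdvec R i)^T *m x) 0 0 + b i 0.
Proof. by rewrite trmx_mul trmxK trmx_delta -mulmxA -rowE !mxE. Qed.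

(** Encoder and diagram are linked only by equations, so that either one can be computed from the
    other. *)
Lemma topk_cell_korder (R : realType) (n d K : nat) (W : 'M[R]_(d, n))
    (b : 'cV[R]_d) (mu : 'I_d -> 'cV[R]_n) (alpha : 'I_d -> R)
    (S : ksubset d K) :
  (forall i, W^T *m stdvec R i = mu i) ->
  (forall i, alpha i = norm2 (mu i) ^+ 2 + 2 * b i 0) ->
  topk_cell W b S = korder_cell mu alpha S.
Proof.
move=> muE alphaE.
have cmp x i j :
    (norm2 (x - mu i) ^+ 2 - alpha i < norm2 (x - mu j) ^+ 2 - alpha j) =
    ((W *m x + b) j 0 < (W *m x + b) i 0).
  by rewrite !(power_distE _ (alphaE _)) ltr_sub_2mull !preactivationE !muE.
by apply/seteqP; split=> x xS i j iS jS; have := xS i j iS jS; rewrite cmp.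
Qed.

Lemma topk_cell_korder_rows (R : realType) (n d K : nat) (W : 'M[R]_(d, n))
    (b : 'cV[R]_d) (mu : 'I_d -> 'cV[R]_n) (alpha : 'I_d -> R)
    (S : ksubset d K) :
  (forall i, (stdvec R i)^T *m W = (mu i)^T) ->
  (forall i, b i 0 = 2^-1 * alpha i - 2^-1 * norm2 (mu i) ^+ 2) ->
  topk_cell W b S = korder_cell mu alpha S.
Proof.
move=> WE bE; apply: topk_cell_korder => i.
  by apply: trmx_inj; rewrite trmx_mul trmxK WE.
by rewrite bE; field.
Qed.

(** * Subsets of size [K] and sums over them *)

Lemma card_ksubset (d K : nat) : #|{: ksubset d K}| = 'C(d, K).
Proof. by rewrite card_sig -cardsE card_draws card_ord. Qed.

Lemma ksubset_setD (d K : nat) (S S' : ksubset d K) :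
  S' <> S -> exists i, i \in (val S :\: val S')%SET.
Proof.
move=> neqS; apply/finset.set0Pn; rewrite finset.setD_eq0; apply/negP => sSS'.
apply: neqS; apply/val_inj/esym/eqP.
by rewrite eqEcard sSS' (eqP (valP S)) (eqP (valP S')) leqnn.
Qed.

Lemma card_ksubset_setD (d K : nat) (S S' : ksubset d K) :
  #|(val S :\: val S')%SET| = #|(val S' :\: val S)%SET|.
Proof.
by rewrite !cardsD (eqP (valP S)) (eqP (valP S')) finset.setIC.
Qed.

(** The common part of the two sums cancels. The differences [S \ S'] and [S' \ S] are nonempty and
    equally large, and the least value of [z] on the first exceeds every value on the second. *)
Lemma ltr_sum_ksubset (R : realType) (d K : nat) (z : 'I_d -> R)
    (S S' : ksubset d K) :
  S' <> S -> (forall i j, i \in val S -> j \notin val S -> z j < z i) ->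
  \sum_(i in val S') z i < \sum_(i in val S) z i.
Proof.
move=> neqS domS; have [i0 i0P] := ksubset_setD neqS.
have [j0 j0P] := ksubset_setD (nesym neqS).
rewrite (big_setID (val S)) [ltRHS](big_setID (val S')) /=.
rewrite finset.setIC ltrD2l.
have [m mP m_min] :=
  arg_minP (P := fun i => i \in (val S :\: val S')%SET) z i0P.
have mS : m \in val S by move: mP; rewrite /= finset.in_setD => /andP[].
apply: (@lt_le_trans _ _ (\sum_(i in (val S' :\: val S)%SET) z m)).
  apply: ltr_sum; first by apply/hasP; exists j0; rewrite ?mem_index_enum.
  by move=> j; rewrite finset.inE => /andP[jS _]; exact: domS.
by rewrite sumr_const -card_ksubset_setD -sumr_const; apply: ler_sum.
Qed.

(** Exchanging [i] for [j] in [S] gives a competitor whose sum differs by [z j - z i]. *)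
Lemma ltr_sum_ksubset_exchange (R : realType) (d K : nat) (z : 'I_d -> R)
    (S : ksubset d K) :
  (forall S' : ksubset d K, S' <> S ->
     \sum_(i in val S') z i < \sum_(i in val S) z i) ->
  forall i j, i \in val S -> j \notin val S -> z j < z i.
Proof.
move=> maxS i j iS jS.
have jSi : j \notin (val S :\ i)%SET by rewrite !finset.inE (negbTE jS) andbF.
have cS' : #|(j |: (val S :\ i))%SET| == K.
  by have := eqP (valP S); rewrite cardsU1 jSi (cardsD1 i (val S)) iS => ->.
have neqS : exist (fun A : {set 'I_d} => #|A| == K) _ cS' <> S.
  by move=> eqS; move: jS; rewrite -eqS /= !finset.inE eqxx.
have := maxS _ neqS; rewrite /= big_setU1 //= (big_setD1 i iS) /=.
by rewrite ltrD2r.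
Qed.

Lemma topk_cell_power (R : realType) (n d K : nat) (W : 'M[R]_(d, n))
    (b : 'cV[R]_d) (S : ksubset d K) :
  (1 <= K)%N ->
  topk_cell W b S =
  power_cell
    (fun S0 : ksubset d K =>
       K%:R^-1 *: \sum_(i in val S0) (W^T *m stdvec R i))
    (fun S0 : ksubset d K =>
       norm2 (K%:R^-1 *: \sum_(i in val S0) (W^T *m stdvec R i)) ^+ 2
       + K%:R^-1 * \sum_(i in val S0) (2 * b i 0))
    S.
Proof.
move=> K_gt0; pose z x i := (W *m x + b) i 0.
have Ki_gt0 : 0 < K%:R^-1 :> R by rewrite invr_gt0 ltr0n.
set nu := fun S0 : ksubset d K => _ *: _; set beta := fun S0 : ksubset d K => _.
have betaE S0 : beta S0 =
    norm2 (nu S0) ^+ 2 + 2 * (K%:R^-1 * \sum_(i in val S0) b i 0).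
  by rewrite /beta -mulr_sumr mulrCA.
(* By linearity, the averaged centroid and the averaged bias yield the average pre-activation over
   [S0]. *)
have nuE x S0 : ((nu S0)^T *m x) 0 0 + K%:R^-1 * \sum_(i in val S0) b i 0 =
    K%:R^-1 * \sum_(i in val S0) z x i.
  rewrite linearZ /= -scalemxAl mxE -mulrDr; congr (_ * _).
  rewrite raddf_sum mulmx_suml summxE -big_split /=.
  by apply: eq_bigr => i _; rewrite /z preactivationE.
have cmp x S1 S2 :
    (norm2 (x - nu S1) ^+ 2 - beta S1 < norm2 (x - nu S2) ^+ 2 - beta S2) =
    (\sum_(i in val S2) z x i < \sum_(i in val S1) z x i).
  by rewrite !(power_distE _ (betaE _)) ltr_sub_2mull !nuE ltr_pM2l.
apply/seteqP; split=> x xS.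
  by move=> S' neqS; rewrite cmp; apply: ltr_sum_ksubset.
move=> i j; apply: (ltr_sum_ksubset_exchange (z := z x)) => S' neqS.
by rewrite -cmp; exact: xS.
Qed.

(** * Affineness of the autoencoder on cells *)

Lemma restrict_toE (R : realType) (d : nat) (S : {set 'I_d}) (z : 'cV[R]_d) :
  restrict_to S z = diag_mx (\row_i (i \in S)%:R) *m z.
Proof.
rewrite mul_diag_mx; apply/colP => i; rewrite !mxE.
by case: ifP; rewrite ?mul1r ?mul0r.
Qed.

(** The strict inequalities of the cell leave no choice to the tie-breaking rule: if it selected
    [S' <> S], some entry in [S' \ S] would be at least one in [S \ S']. *)
Lemma is_topk_cell (R : realType) (n d K : nat) (T : 'cV[R]_d -> 'cV[R]_d)
    (W : 'M[R]_(d, n)) (b : 'cV[R]_d) (S : ksubset d K) (x : 'cV[R]_n) :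
  is_topk K T -> topk_cell W b S x ->
  T (W *m x + b) = restrict_to (val S) (W *m x + b).
Proof.
move=> /(_ (W *m x + b)) [S' [domS' ->]] xS.
have [->//|/eqP neqS] := eqVneq S' S.
have [i] := ksubset_setD neqS; rewrite finset.inE => /andP[iS' iS].
have [j] := ksubset_setD (nesym neqS); rewrite finset.inE => /andP[jS jS'].
by have := domS' j i jS' iS'; rewrite leNgt xS.
Qed.

Lemma affine_on_sae (R : realType) (n d K : nat) (T : 'cV[R]_d -> 'cV[R]_d)
    (W : 'M[R]_(d, n)) (b : 'cV[R]_d) (Wdec : 'M[R]_(n, d)) (bdec : 'cV[R]_n)
    (S : ksubset d K) :
  is_topk K T -> affine_on (topk_cell W b S) (sae T W b Wdec bdec).
Proof.
move=> topkT; pose P : 'M[R]_d := diag_mx (\row_i (i \in val S)%:R).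
exists (Wdec *m P *m W), (Wdec *m P *m b + bdec) => x xS.
by rewrite /sae (is_topk_cell topkT xS) restrict_toE !mulmxDr !mulmxA addrA.
Qed.

(** * The counterexample on the line *)

(** The left sides minus the right sides of the hypotheses change by slope difference times
    displacement; the biases cancel. *)
Lemma line_topk_crossing (R : realType) (W : 'M[R]_(4, 1)) (b : 'cV[R]_4)
    (x y : 'cV[R]_1) (i j : 'I_4) :
  (W *m x + b) j 0 < (W *m x + b) i 0 ->
  (W *m y + b) i 0 < (W *m y + b) j 0 ->
  0 < (W i 0 - W j 0) * (x 0 0 - y 0 0).
Proof. by rewrite !mxE !big_ord1; nra. Qed.

Lemma line_topk_some_cell_empty (R : realType) (W : 'M[R]_(4, 1))
    (b : 'cV[R]_4) :
  ~ forall S : ksubset 4 2, exists x, topk_cell W b S x.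
Proof.
move=> ne.
pose o k : 'I_4 := inord k.
have oE k l : (k < 4)%N -> (l < 4)%N -> (o k == o l) = (k == l).
  by move=> k4 l4; rewrite -val_eqE /= !inordK.
(* Indices are kept as natural numbers, so that all side conditions below hold by computation. *)
have pair k l : (k < 4)%N -> (l < 4)%N -> k != l ->
    exists x : 'cV[R]_1, forall i j, i \in [:: k; l] -> j \notin [:: k; l] ->
      (i < 4)%N -> (j < 4)%N -> (W *m x + b) (o j) 0 < (W *m x + b) (o i) 0.
  move=> k4 l4 kl.
  have cS : #|[set o k; o l]%SET| == 2%N by rewrite cards2 oE // kl.
  have [x xS] := ne (exist (fun A : {set 'I_4} => #|A| == 2%N) _ cS).
  exists x => i j ikl jkl i4 j4.
  by apply: xS; rewrite /= !finset.inE !oE //;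
    move: ikl jkl; rewrite !finset.inE.
have [x01 h01] := pair 0%N 1%N isT isT isT.
have [x23 h23] := pair 2%N 3%N isT isT isT.
have [x02 h02] := pair 0%N 2%N isT isT isT.
have [x13 h13] := pair 1%N 3%N isT isT isT.
(* [p1] and [p2] give [x01 - x23] and [x02 - x13] the same sign, that of the slope difference of
   entries 0 and 3. With entries 1 and 2, [p3] and [p4] give them opposite signs. *)
have p1 :=
  line_topk_crossing (h01 0%N 3%N isT isT isT isT) (h23 3%N 0%N isT isT isT isT).
have p2 :=
  line_topk_crossing (h02 0%N 3%N isT isT isT isT) (h13 3%N 0%N isT isT isT isT).
have p3 :=
  line_topk_crossing (h01 1%N 2%N isT isT isT isT) (h23 2%N 1%N isT isT isT isT).
have p4 :=
  line_topk_crossing (h02 2%N 1%N isT isT isT isT) (h13 1%N 2%N isT isT isT isT).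
(* Multiplying all four avoids a case split on signs: the product is minus a square, yet
   positive. *)
have := mulr_gt0 (mulr_gt0 p1 p2) (mulr_gt0 p3 p4).
set u := W _ _ - W _ _; set v := W (o 1%N) 0 - W _ _.
rewrite -(opprB (W (o 1%N) 0)) -/v; set s := x01 _ _ - _; set t := x02 _ _ - _.
have -> : u * s * (u * t) * (v * s * (- v * t)) = - (u * s * v * t) ^+ 2.
  by ring.
by rewrite oppr_gt0 ltNge sqr_ge0.
Qed.

(** With zero weights the cells are Voronoi cells, and a centroid is at distance zero only from
    itself. *)
Lemma power_cell_centroid (R : realType) (n : nat) (I : Type)
    (mu : I -> 'cV[R]_n) (i : I) :
  injective mu -> power_cell mu (fun=> 0) i (mu i).
Proof.
move=> mu_inj j neq; rewrite !subr0 subrr !sqr_norm2.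
rewrite big1; last by move=> k _; rewrite mxE expr0n.
rewrite lt_neqAle eq_sym sumr_ge0 ?andbT; last by move=> k _; exact: sqr_ge0.
apply/negP => /eqP s0; apply: neq; apply/mu_inj/esym/colP => k.
apply/eqP; rewrite -subr_eq0.
have : (mu i - mu j) k 0 ^+ 2 = 0.
  by apply: psumr_eq0P s0 _ _ => // l _; exact: sqr_ge0.
by move/eqP; rewrite sqrf_eq0 !mxE.
Qed.

Lemma power_diagram_not_topk (R : realType) :
  exists (mu : 'I_('C(4, 2)) -> 'cV[R]_1) (alpha : 'I_('C(4, 2)) -> R),
  forall (W : 'M[R]_(4, 1)) (b : 'cV[R]_4),
    ~ same_cells (power_cell mu alpha) (fun S : ksubset 4 2 => topk_cell W b S).
Proof.
(* The centroids are the points 0 to 5 of the line. *)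
pose mu (i : 'I_('C(4, 2))) : 'cV[R]_1 := const_mx (i%:R).
have mu_inj : injective mu.
  move=> i j /matrixP /(_ 0 0); rewrite !mxE => /eqP; rewrite eqr_nat.
  by move=> /eqP /val_inj.
exists mu, (fun=> 0) => W b [f [[g _ fK] fE]].
apply: (@line_topk_some_cell_empty R W b) => S; exists (mu (g S)).
by rewrite -(fK S) -fE fK; exact: power_cell_centroid.
Qed.

Theorem theorem2p3 (R : realType) (n d K : nat)
    (hK : (1 <= K)%N) (hKd : (K <= d)%N) :
  (#|{: ksubset d K}| = 'C(d, K) /\
   forall (Wenc : 'M[R]_(d, n)) (benc : 'cV[R]_d) (S : ksubset d K),
     topk_cell Wenc benc S =
     korder_cell
       (fun i : 'I_d => Wenc^T *m stdvec R i)
       (fun i : 'I_d => 2 * benc i 0 + norm2 (Wenc^T *m stdvec R i) ^+ 2)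
       S) /\
  (forall (mu : 'I_d -> 'cV[R]_n) (alpha : 'I_d -> R),
     (exists (Wenc : 'M[R]_(d, n)) (benc : 'cV[R]_d),
        (forall S : ksubset d K,
           topk_cell Wenc benc S = korder_cell mu alpha S) /\
        (forall (T : 'cV[R]_d -> 'cV[R]_d)
                (Wdec : 'M[R]_(n, d)) (bdec : 'cV[R]_n),
           is_topk K T ->
           forall S : ksubset d K,
             affine_on (korder_cell mu alpha S)
                       (sae T Wenc benc Wdec bdec))) /\
     (forall (Wenc : 'M[R]_(d, n)) (benc : 'cV[R]_d),
        (forall i : 'I_d, (stdvec R i)^T *m Wenc = (mu i)^T) ->
        (forall i : 'I_d,
           benc i 0 = 2^-1 * alpha i - 2^-1 * norm2 (mu i) ^+ 2) ->
        forall S : ksubset d K,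
          topk_cell Wenc benc S = korder_cell mu alpha S)) /\
  (forall (Wenc : 'M[R]_(d, n)) (benc : 'cV[R]_d) (S : ksubset d K),
     topk_cell Wenc benc S =
     power_cell
       (fun S0 : ksubset d K =>
          K%:R^-1 *: \sum_(i in val S0) (Wenc^T *m stdvec R i))
       (fun S0 : ksubset d K =>
          norm2 (K%:R^-1 *: \sum_(i in val S0) (Wenc^T *m stdvec R i)) ^+ 2
          + K%:R^-1 * \sum_(i in val S0) (2 * benc i 0))
       S) /\
  (exists n' d' K' : nat,
     [/\ (0 < n')%N, (1 <= K')%N, (K' <= d')%N &
      exists (mu : 'I_('C(d', K')) -> 'cV[R]_n') (alpha : 'I_('C(d', K')) -> R),
      forall (Wenc : 'M[R]_(d', n')) (benc : 'cV[R]_d'),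
        ~ same_cells (power_cell mu alpha)
                     (fun S : ksubset d' K' => topk_cell Wenc benc S)]) /\
  (forall (nu : 'I_('C(d, K)) -> 'cV[R]_n) (beta : 'I_('C(d, K)) -> R),
     (exists (Wenc : 'M[R]_(d, n)) (benc : 'cV[R]_d),
        same_cells (power_cell nu beta)
                   (fun S : ksubset d K => topk_cell Wenc benc S)) <->
     (exists (mu : 'I_d -> 'cV[R]_n) (alpha : 'I_d -> R),
        same_cells (power_cell nu beta)
                   (fun S : ksubset d K => korder_cell mu alpha S))).
Proof.
have encode (mu : 'I_d -> 'cV[R]_n) (alpha : 'I_d -> R) :
    exists (W : 'M[R]_(d, n)) (b : 'cV[R]_d),
    forall S : ksubset d K, topk_cell W b S = korder_cell mu alpha S.
  exists (\matrix_i (mu i)^T).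
  exists (\col_i (2^-1 * alpha i - 2^-1 * norm2 (mu i) ^+ 2)) => S.
  apply: topk_cell_korder_rows => i; last by rewrite mxE.
  by rewrite trmx_delta -rowE rowK.
have decode (W : 'M[R]_(d, n)) (b : 'cV[R]_d) (S : ksubset d K) :
    topk_cell W b S =
    korder_cell (fun i => W^T *m stdvec R i)
      (fun i => 2 * b i 0 + norm2 (W^T *m stdvec R i) ^+ 2) S.
  by apply: topk_cell_korder => // i; rewrite addrC.
split; first by split; [exact: card_ksubset | exact: decode].
split.
  move=> mu alpha; split; last first.
    by move=> W b WE bE S; exact: topk_cell_korder_rows.
  have [W [b WbE]] := encode mu alpha; exists W, b; split=> //.
  move=> T Wdec bdec topkT S.
  by rewrite -WbE; exact: affine_on_sae.
split; first by move=> W b S; exact: topk_cell_power.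
split; first by exists 1%N, 4%N, 2%N; split=> //; exact: power_diagram_not_topk.
(* [decode] and [encode] match cells with the same [S], so the bijection [f] is reused unchanged. *)
move=> nu beta; split=> [[W [b [f [f_bij fE]]]] | [mu [alpha [f [f_bij fE]]]]].
  exists (fun i => W^T *m stdvec R i).
  exists (fun i => 2 * b i 0 + norm2 (W^T *m stdvec R i) ^+ 2).
  by exists f; split=> // i; rewrite fE decode.
have [W [b WbE]] := encode mu alpha.
by exists W, b, f; split=> // i; rewrite fE WbE.
Qed.
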